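(* Let $n\ge1$ be an integer, $L>0$, $r>0$, and let $Q_2\in\mathbb{R}^{n\times n}$ be symmetric with $Q_2\mathbf{1}=0$ and $\zeta^TQ_2\zeta>0$ for all $\zeta\neq0$ with $\zeta^T\mathbf{1}=0$. Put $$A=\begin{bmatrix} 0 & I \\ -\tfrac{1}{L} I & 0 \end{bmatrix},\quad B=\begin{bmatrix} 0 \\ I \end{bmatrix},\quad C=\begin{bmatrix} 0 & I \end{bmatrix},\quad Q=\begin{bmatrix} 0 & 0 \\ 0 & Q_2 \end{bmatrix},\quad R=rI,$$ with $n\times n$ blocks. For $K\in\mathcal{L}$ let $J(K)=\operatorname{trace}(P(K)BB^T)$, where $P(K)$ is a matrix $P\succeq0$ of least value of $\operatorname{trace}(PBB^T)$ among all $P\succeq 0$ satisfying $$(A-BKC)^TP+P(A-BKC)=-(Q+C^TK^TRKC).$$ Then $$\nabla_KJ=-\tfrac12\,(K+\mathbf{1}\mathbf{1}^T/n)^{-1}Q_2(K+\mathbf{1}\mathbf{1}^T/n)^{-1}+\tfrac r2\,(I-\mathbf{1}\mathbf{1}^T/n).$$ In particular, setting $\nabla_KJ=0$ gives $K=Q_2^{1/2}/r^{1/2}$ as a necessary and sufficient condition for the optimality of $K$ (that is, for $K\in\mathcal{L}$ to minimize $J$ over $\mathcal{L}$).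
   Context: $\mathbf{1}\in\mathbb{R}^n$ is the column vector of all ones. The set of weighted Laplacians of connected graphs is $$\mathcal{L}:=\{K\in\mathbb{R}^{n\times n}\mid K=K^T,\ K\mathbf{1}=0,\ K+\mathbf{1}\mathbf{1}^T/n\succ0,\ K_{ij}\le0\text{ for }i\ne j\}.$$ $\succeq,\succ$ denote inequalities in the semidefinite sense for symmetric matrices ($P\succeq0$ includes symmetry of $P$); $I$ is the $n\times n$ identity matrix; $Q_2^{1/2}$ is the positive semidefinite square root of $Q_2$. The gradient $\nabla_KJ$ takes into account that $K$ is restricted to $\mathcal{L}$: it is the gradient within the linear space $\mathcal{S}=\{S=S^T:\ S\mathbf{1}=0\}$ with inner product $\langle S,T\rangle=\operatorname{trace}(ST)$, that is, $\nabla_KJ$ is the element of $\mathcal{S}$ such that $J(K+E)=J(K)+\operatorname{trace}(\nabla_KJ\,E)+o(\|E\|)$ for $E\in\mathcal{S}$, $E\to0$, where $J$ is extended by the same definition to all $K\in\mathcal{S}$ with $K+\mathbf{1}\mathbf{1}^T/n\succ0$, an open subset of $\mathcal{S}$.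
   Formalization: Necessity of K = Q_2^{1/2}/r^{1/2} for optimality over 𝓛 fails when that matrix has a positive off-diagonal entry (lies outside 𝓛), so the optimality equivalence over 𝓛 is stated assuming Q_2^{1/2}/r^{1/2} ∈ 𝓛; it is also stated without the sign constraints. *)

(* Defs.v *)
From mathcomp Require Export all_boot all_order all_algebra.
From mathcomp Require Export all_classical all_reals all_analysis.

Set Implicit Arguments.
Unset Strict Implicit.
Unset Printing Implicit Defensive.

Export Order.TTheory GRing.Theory Num.Theory.
Export numFieldNormedType.Exports.

#[global] Open Scope classical_set_scope.
#[global] Open Scope ring_scope.

Definition psd (R : realType) (n : nat) (M : 'M[R]_n) : Prop :=
  M^T = M /\ forall x : 'cV[R]_n, 0 <= (x^T *m M *m x) 0 0.

Definition pd (R : realType) (n : nat) (M : 'M[R]_n) : Prop :=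
  M^T = M /\ forall x : 'cV[R]_n, x != 0 -> 0 < (x^T *m M *m x) 0 0.

(* The default value 0 is returned only if M has no psd square root. *)
Definition psd_sqrt (R : realType) (n : nat) (M : 'M[R]_n) : 'M[R]_n :=
  xget 0 [set S | psd S /\ S *m S = M].

Definition ones (R : realType) (n : nat) : 'cV[R]_n := const_mx 1.

Definition averaging (R : realType) (n : nat) : 'M[R]_n :=
  n%:R^-1 *: (ones R n *m (ones R n)^T).

Definition laplacians (R : realType) (n : nat) : set 'M[R]_n :=
  [set K | [/\ K^T = K, K *m ones R n = 0, pd (K + averaging R n)
             & forall i j, i != j -> K i j <= 0]].

Definition zero_sum_sym (R : realType) (n : nat) : set 'M[R]_n :=
  [set S | S^T = S /\ S *m ones R n = 0].

(* The open subset of [zero_sum_sym] on which the cost is differentiated: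
   [laplacians] without the sign constraints. *)
Definition signed_laplacians (R : realType) (n : nat) : set 'M[R]_n :=
  [set K | zero_sum_sym K /\ pd (K + averaging R n)].

Definition sysA (R : realType) (n : nat) (ell : R) : 'M[R]_(n + n) :=
  block_mx 0 1%:M (- (ell^-1)%:M) 0.

Definition sysB (R : realType) (n : nat) : 'M[R]_(n + n, n) :=
  col_mx 0 1%:M.

Definition sysC (R : realType) (n : nat) : 'M[R]_(n, n + n) :=
  row_mx 0 1%:M.

Definition costQ (R : realType) (n : nat) (Q2 : 'M[R]_n) : 'M[R]_(n + n) :=
  block_mx 0 0 0 Q2.

Definition costR (R : realType) (n : nat) (r : R) : 'M[R]_n := r%:M.

Definition closed_loop (R : realType) (n : nat) (ell : R) (K : 'M[R]_n) :
    'M[R]_(n + n) :=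
  sysA n ell - sysB R n *m K *m sysC R n.

Definition lyapunov_solution (R : realType) (n : nat) (ell r : R)
    (Q2 K : 'M[R]_n) : set 'M[R]_(n + n) :=
  [set P | psd P /\
     (closed_loop ell K)^T *m P + P *m closed_loop ell K =
     - (costQ Q2 + (sysC R n)^T *m K^T *m costR n r *m K *m sysC R n)].

Definition is_minimizer (T : Type) (R : realType) (D : set T) (f : T -> R)
    (x : T) : Prop :=
  D x /\ forall y, D y -> f x <= f y.

(* The Lyapunov equation has several psd solutions, because the average mode
   is undamped and carries no cost: hence the selection by least trace.  The
   default value 0 is returned only if there is no minimizer. *)
Definition least_lyapunov (R : realType) (n : nat) (ell r : R)
    (Q2 K : 'M[R]_n) : 'M[R]_(n + n) :=
  xget 0 (is_minimizer (lyapunov_solution ell r Q2 K)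
            (fun P => \tr (P *m (sysB R n *m (sysB R n)^T)))).

Definition cost (R : realType) (n : nat) (ell r : R) (Q2 K : 'M[R]_n) : R :=
  \tr (least_lyapunov ell r Q2 K *m (sysB R n *m (sysB R n)^T)).

(* G is the gradient of f at K within the space [zero_sum_sym], for the inner
   product \tr (S *m T). *)
Definition is_gradient (R : realType) (n : nat) (f : 'M[R]_n -> R)
    (K G : 'M[R]_n) : Prop :=
  zero_sum_sym G /\
  forall eps : R, 0 < eps ->
    \forall E \near (0 : 'M[R]_n), zero_sum_sym E ->
      `|f (K + E) - f K - \tr (G *m E)| <= eps * `|E|.

(* Main.v *)
Require Import Defs.
From mathcomp Require Import ring lra.

(* Writing W for the averaging matrix and N for (K + W)^-1, the velocity block X
   of any solution of the Lyapunov equation satisfies K X + X K = Q2 + r K^2;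
   multiplying by N, with N K = K N = 1 - W, and taking traces gives
   tr X = tr (W X) + (tr (N Q2) + r tr K) / 2.  The minimal trace is reached by
   the solution diag (X / ell, X) where X kills the ones vector, whence
   J(K) = (tr (N Q2) + r tr K) / 2.  The gradient is read off the second-order
   expansion of the inverse, and it vanishes iff Q2 = r K^2, that is, iff
   sqrt r K is the psd square root of Q2.  Optimality of such an S follows by
   completing the square:
   J(K) - J(S) = r / 2 * tr ((S - K) N (S - K)). *)

Set Implicit Arguments.
Unset Strict Implicit.
Unset Printing Implicit Defensive.

(** * Quadratic forms, definiteness and entrywise norm bounds *)

Definition quad (R : realType) n (M : 'M[R]_n) (x : 'cV[R]_n) : R :=
  (x^T *m M *m x) 0 0.

Section QuadraticForms.
Variables (R : realType) (n : nat).
Implicit Types (M N : 'M[R]_n) (x y : 'cV[R]_n).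

Lemma quadDl M N x : quad (M + N) x = quad M x + quad N x.
Proof. by rewrite /quad mulmxDr mulmxDl mxE. Qed.

Lemma quadZl a M x : quad (a *: M) x = a * quad M x.
Proof. by rewrite /quad -scalemxAr -scalemxAl mxE. Qed.

Lemma quad1 x : quad 1%:M x = \sum_i x i 0 ^+ 2.
Proof.
by rewrite /quad mulmx1 mxE; apply: eq_bigr => i _; rewrite mxE expr2.
Qed.

Lemma quad1_ge0 x : 0 <= quad 1%:M x.
Proof. by rewrite quad1 sumr_ge0 // => i _; rewrite sqr_ge0. Qed.

Lemma quad1_eq0 x : quad 1%:M x = 0 -> x = 0.
Proof.
rewrite quad1 => /eqP; rewrite psumr_eq0 => [/allP h|i _]; last exact: sqr_ge0.
apply/matrixP => i j; rewrite ord1 mxE.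
by have := h i (mem_index_enum _); rewrite sqrf_eq0 => /eqP.
Qed.

Lemma le_sqr_quad1 x i : x i 0 ^+ 2 <= quad 1%:M x.
Proof. by rewrite quad1 (bigD1 i) //= lerDl sumr_ge0 // => j _; rewrite sqr_ge0. Qed.

Lemma bilinearC M x y : M^T = M -> (x^T *m M *m y) 0 0 = (y^T *m M *m x) 0 0.
Proof.
by move=> MT; rewrite -trace_mx11 -mxtrace_tr !trmx_mul trmxK MT mulmxA trace_mx11.
Qed.

Lemma quad_shift M x y t : M^T = M ->
  quad M (x + t *: y) = quad M x + 2 * t * (y^T *m M *m x) 0 0 + t ^+ 2 * quad M y.
Proof.
move=> MT; rewrite /quad.
have -> : (x + t *: y)^T = x^T + t *: y^T by rewrite linearD linearZ.
rewrite !(mulmxDl, mulmxDr).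
rewrite -!(scalemxAl, scalemxAr) -!trace_mx11 !(mxtraceD, mxtraceZ) !trace_mx11.
rewrite (bilinearC x y MT); ring.
Qed.

(** The polynomial [t |-> quad M (x + t *: y)] is nonnegative; evaluate it at its minimum. *)
Lemma psd_cauchy_schwarz M x y : psd M ->
  ((y^T *m M *m x) 0 0) ^+ 2 <= quad M y * quad M x.
Proof.
move=> [MT M0]; set b := (y^T *m M *m x) 0 0.
have h t : 0 <= quad M x + 2 * t * b + t ^+ 2 * quad M y.
  by rewrite -quad_shift //; exact: M0.
have a0 : 0 <= quad M x by exact: M0.
have : 0 <= quad M y by exact: M0.
rewrite le_eqVlt => /predU1P[c0|c0].
  rewrite -c0 mul0r; have [->|b0] := eqVneq b 0; first by rewrite expr0n.
  (* Here the polynomial is affine with slope [2 * b]; this [t] would give it the value -1. *)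
  have := h (- (quad M x + 1) / (2 * b)); rewrite -c0 mulr0 addr0.
  have -> : 2 * (- (quad M x + 1) / (2 * b)) * b = - (quad M x + 1) by field.
  lra.
have := h (- b / quad M y).
have -> : quad M x + 2 * (- b / quad M y) * b + (- b / quad M y) ^+ 2 * quad M y
   = (quad M y * quad M x - b ^+ 2) / quad M y by field; rewrite gt_eqF.
by rewrite pmulr_lge0 ?invr_gt0 // subr_ge0.
Qed.

(** Cauchy-Schwarz with [y = M *m x] bounds the square of [quad 1%:M (M *m x)] by a multiple of
    [quad M x]. *)
Lemma psd_quad_eq0 M x : psd M -> quad M x = 0 -> M *m x = 0.
Proof.
move=> Mpsd q0; apply: quad1_eq0; apply/eqP.
have := psd_cauchy_schwarz x (M *m x) Mpsd.
rewrite q0 mulr0 -mulmxA => h; have : quad 1%:M (M *m x) ^+ 2 <= 0.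
  by rewrite /quad mulmx1.
by rewrite -sqrf_eq0 eq_le sqr_ge0 => ->.
Qed.

Lemma pd_psd M : pd M -> psd M.
Proof.
move=> [MT M0]; split=> // x; have [->|/M0/ltW //] := eqVneq x 0.
by rewrite mulmx0 mxE.
Qed.

Lemma psd_pd M : psd M -> (forall x, M *m x = 0 -> x = 0) -> pd M.
Proof.
move=> Mpsd inj; have [MT M0] := Mpsd; split=> // x x0.
rewrite lt_neqAle M0 andbT eq_sym; apply: contraNneq x0 => q0.
exact/eqP/inj/psd_quad_eq0.
Qed.

Lemma pd_mulmx_eq0 M x : pd M -> M *m x = 0 -> x = 0.
Proof.
move=> [_ M0] Mx; apply/eqP/negPn/negP => /M0.
by rewrite -mulmxA Mx mulmx0 mxE ltxx.
Qed.

Lemma pd_unitmx M : pd M -> M \in unitmx.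
Proof.
move=> Mpd; rewrite -row_free_unit; apply: inj_row_free => v vM.
apply: trmx_inj; rewrite trmx0; apply: (pd_mulmx_eq0 Mpd).
by rewrite -[M]trmxK (proj1 Mpd) -trmx_mul vM trmx0.
Qed.

Lemma pd_invmx M : pd M -> pd (invmx M).
Proof.
move=> Mpd; have Mu := pd_unitmx Mpd; have [MT M0] := Mpd.
split; first by rewrite trmx_inv MT.
move=> x x0; have /M0 : invmx M *m x != 0.
  by apply: contraNneq x0 => h; rewrite -[x](mulKVmx Mu) h mulmx0.
by rewrite trmx_mul trmx_inv MT !mulmxA mulmxKV.
Qed.

Lemma mx_entry_norm m p (A : 'M[R]_(m, p)) i j : `|A i j| <= `|A|.
Proof.
by rewrite [leRHS]/Num.norm /= mx_normrE; apply/bigmax_geP; right => /=; exists (i, j).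
Qed.

Lemma mx_norm_le m p (A : 'M[R]_(m, p)) (c : R) : 0 <= c ->
  (forall i j, `|A i j| <= c) -> `|A| <= c.
Proof.
by move=> c0 h; rewrite [leLHS]/Num.norm /= mx_normrE; apply/bigmax_leP; split.
Qed.

(** The norm is the largest absolute value of an entry, hence submultiplicative only up to a factor
    [n]. *)
Lemma mx_norm_mul (A B : 'M[R]_n) : `|A *m B| <= n%:R * (`|A| * `|B|).
Proof.
apply: mx_norm_le => [|i j]; first by rewrite !mulr_ge0.
rewrite mxE (le_trans (ler_norm_sum _ _ _)) // -[n in n%:R]card_ord mulr_natl.
rewrite -sumr_const; apply: ler_sum => k _.
by rewrite normrM ler_pM // mx_entry_norm.
Qed.

Lemma norm_mxtrace (A : 'M[R]_n) : `|\tr A| <= n%:R * `|A|.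
Proof.
rewrite (le_trans (ler_norm_sum _ _ _)) // -[n in n%:R]card_ord mulr_natl.
by rewrite -sumr_const; apply: ler_sum => k _; rewrite mx_entry_norm.
Qed.

(** Each of the [n ^ 2] terms is at most [|M|] times the squared length of [x], by the inequality
    between geometric and arithmetic means. *)
Lemma norm_quad_le M x : `|quad M x| <= n%:R ^+ 2 * `|M| * quad 1%:M x.
Proof.
have -> : quad M x = \sum_j \sum_i x i 0 * M i j * x j 0.
  rewrite /quad mxE; apply: eq_bigr => j _; rewrite mxE mulr_suml.
  by apply: eq_bigr => i _; rewrite mxE.
have bnd i j : `|x i 0 * M i j * x j 0| <= `|M| * quad 1%:M x.
  have -> : `|x i 0 * M i j * x j 0| = `|M i j| * (`|x i 0| * `|x j 0|).
    by rewrite !normrM; ring.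
  apply: ler_pM => //; first exact: mx_entry_norm.
  have := le_sqr_quad1 x i; have := le_sqr_quad1 x j.
  rewrite -(real_normK (num_real (x i 0))) -(real_normK (num_real (x j 0))).
  have := sqr_ge0 (`|x i 0| - `|x j 0|); nra.
rewrite (le_trans (ler_norm_sum _ _ _)) // expr2 -!mulrA.
rewrite -{1}[n in n%:R]card_ord mulr_natl -sumr_const; apply: ler_sum => j _.
rewrite (le_trans (ler_norm_sum _ _ _)) //.
by rewrite -{1}[n in n%:R]card_ord mulr_natl -sumr_const; apply: ler_sum => i _.
Qed.

(* Cauchy-Schwarz for the form of M, applied to x = M (M^-1 x), bounds the form
   of M below by a bound above for the form of M^-1. *)
Lemma pd_coercive M : pd M ->
  exists2 d : R, 0 < d & forall x, d * quad 1%:M x <= quad M x.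
Proof.
move=> Mpd; have Mu := pd_unitmx Mpd; have Npd := pd_invmx Mpd.
set N := invmx M in Npd; set c := n%:R ^+ 2 * `|N| + 1.
have c0 : 0 < c by rewrite ltr_wpDl // !mulr_ge0.
exists c^-1; rewrite ?invr_gt0 // => x; rewrite ler_pdivrMl //.
have s0 := quad1_ge0 x.
have Nc : quad N x <= c * quad 1%:M x.
  apply: (le_trans (ler_norm _)); apply: (le_trans (norm_quad_le _ _)).
  by rewrite /c mulrDl mul1r lerDl.
have : quad 1%:M x ^+ 2 <= quad M x * quad N x.
  have := psd_cauchy_schwarz (N *m x) x (pd_psd Mpd).
  rewrite /quad mulmx1 -!mulmxA [M *m (N *m x)]mulKVmx // trmx_mul (proj1 Npd).
  by rewrite !mulmxA.
have q0 : 0 <= quad M x by have [_] := pd_psd Mpd; exact.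
move: s0; rewrite le_eqVlt => /predU1P[<-|s0] h; first by rewrite mulr_ge0 // ltW.
by rewrite -(ler_pM2r s0) -expr2 (le_trans h) // -mulrA mulrCA ler_wpM2l.
Qed.

(** A form bounded below by [c] times the squared length stays positive under a perturbation whose
    form is smaller than that. *)
Lemma pd_open M : pd M ->
  exists2 d : R, 0 < d & forall E : 'M[R]_n, E^T = E -> `|E| < d -> pd (M + E).
Proof.
move=> Mpd; have [c c0 hc] := pd_coercive Mpd.
(* The [+ 1] keeps the denominator positive when [n] is 0. *)
exists (c / (n%:R ^+ 2 + 1)); first by rewrite divr_gt0 // ltr_wpDl // sqr_ge0.
move=> E ET; rewrite ltr_pdivlMr ?ltr_wpDl ?sqr_ge0 // => Ec.
split; first by rewrite linearD /= (proj1 Mpd) ET.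
move=> x x0; rewrite -/(quad _ _) quadDl.
have s0 : 0 < quad 1%:M x.
  by rewrite lt_neqAle quad1_ge0 andbT eq_sym; apply: contraNneq x0 => /quad1_eq0/eqP.
have := norm_quad_le E x; have := hc x; rewrite ler_norml.
have : n%:R ^+ 2 * `|E| * quad 1%:M x < c * quad 1%:M x.
  by rewrite ltr_pM2r // (le_lt_trans _ Ec) // mulrDr mulr1 mulrC lerDl.
lra.
Qed.

End QuadraticForms.

(** * Traces as sums of quadratic forms; uniqueness of the psd square root *)

Section TraceForms.
Variable R : realType.

Lemma mxtrace_quad n p (M : 'M[R]_n) (X : 'M[R]_(n, p)) :
  \tr (X^T *m M *m X) = \sum_j quad M (col j X).
Proof.
apply: eq_bigr => j _; rewrite /quad !mxE; apply: eq_bigr => k _.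
by rewrite !mxE; congr (_ * _); apply: eq_bigr => l _; rewrite !mxE.
Qed.

Lemma psd_trace_ge0 n p (M : 'M[R]_n) (X : 'M[R]_(n, p)) :
  psd M -> 0 <= \tr (X^T *m M *m X).
Proof. by move=> [_ M0]; rewrite mxtrace_quad sumr_ge0 // => j _; exact: M0. Qed.

Lemma psd_trace_eq0 n p (M : 'M[R]_n) (X : 'M[R]_(n, p)) :
  psd M -> \tr (X^T *m M *m X) = 0 -> M *m X = 0.
Proof.
move=> Mpsd /eqP; have [_ M0] := Mpsd.
rewrite mxtrace_quad psumr_eq0 => [/allP h|j _]; last exact: M0.
apply/matrixP => i j; have /eqP/(psd_quad_eq0 Mpsd) := h j (mem_index_enum _).
move=> /matrixP/(_ i 0); rewrite !mxE => MX; rewrite -[RHS]MX.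
by apply: eq_bigr => k _; rewrite mxE.
Qed.

Lemma pd_trace_eq0 n p (M : 'M[R]_n) (X : 'M[R]_(n, p)) :
  pd M -> \tr (X^T *m M *m X) = 0 -> X = 0.
Proof.
move=> Mpd /(psd_trace_eq0 (pd_psd Mpd)) MX.
by rewrite -[X](mulKmx (pd_unitmx Mpd)) MX mulmx0.
Qed.

Lemma pd1 n : pd (1%:M : 'M[R]_n).
Proof.
split=> [|x x0]; first exact: trmx1.
rewrite -/(quad _ _) lt_neqAle quad1_ge0 andbT eq_sym.
by apply: contraNneq x0 => /quad1_eq0/eqP.
Qed.

Lemma mxtrace_trmx_mul_eq0 n p (X : 'M[R]_(n, p)) : \tr (X^T *m X) = 0 -> X = 0.
Proof. by rewrite -[X^T]mulmx1; apply/pd_trace_eq0/pd1. Qed.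

Lemma mxtrace_trmx_mul_ge0 n p (X : 'M[R]_(n, p)) : 0 <= \tr (X^T *m X).
Proof. by rewrite -[X^T]mulmx1; apply/psd_trace_ge0/pd_psd/pd1. Qed.

(** The difference [D] satisfies [S D + D T = 0]. Multiplying by [D] and taking traces gives two
    nonnegative terms of sum 0, so [S D = T D = 0] and [D D = 0]. *)
Lemma psd_sqrt_inj n (S T : 'M[R]_n) :
  psd S -> psd T -> S *m S = T *m T -> S = T.
Proof.
move=> Spsd Tpsd ST; apply/eqP; rewrite -subr_eq0; apply/eqP.
set D := S - T.
have DT : D^T = D by rewrite linearB /= (proj1 Spsd) (proj1 Tpsd).
have D0 : S *m D + D *m T = 0.
  by rewrite mulmxBr mulmxBl ST addrC subrKA subrr.
have : \tr (D^T *m S *m D) + \tr (D^T *m T *m D) = 0.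
  rewrite [X in _ + X]mxtrace_mulC DT -!mulmxA -mxtraceD -mulmxDr.
  by rewrite D0 mulmx0 mxtrace0.
move=> /eqP; rewrite paddr_eq0 ?psd_trace_ge0 // => /andP[/eqP SD /eqP TD].
apply: mxtrace_trmx_mul_eq0; rewrite DT {1}/D mulmxBl.
by rewrite (psd_trace_eq0 Spsd SD) (psd_trace_eq0 Tpsd TD) subrr mxtrace0.
Qed.

Lemma psd_sqrt_unique n (M S : 'M[R]_n) : psd S -> S *m S = M -> psd_sqrt M = S.
Proof.
move=> Spsd SM; apply: xget_unique => // T [Tpsd TM].
by apply: psd_sqrt_inj => //; rewrite TM SM.
Qed.

(** Existence of a psd square root is left open: the default value 0 is carried along as a second
    case. *)
Lemma psd_sqrtP n (M : 'M[R]_n) :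
  (psd (psd_sqrt M) /\ psd_sqrt M *m psd_sqrt M = M) \/ psd_sqrt M = 0.
Proof. by rewrite /psd_sqrt; case: xgetP => [S -> []|_]; [left|right]. Qed.

End TraceForms.

(** * The equation [M X + X M = C] for positive definite [M] *)

Section Lyapunov.
Variables (R : realType) (n : nat) (M : 'M[R]_n).
Hypothesis Mpd : pd M.

(** Multiplying by [X^T] and taking traces gives two nonnegative terms of sum 0, and the first
    vanishes only at [X = 0]. *)
Lemma lyapunov_inj (X : 'M[R]_n) : M *m X + X *m M = 0 -> X = 0.
Proof.
move=> X0; have : \tr (X^T *m M *m X) + \tr (X^T^T *m M *m X^T) = 0.
  rewrite trmxK [X in _ + X]mxtrace_mulC -!mulmxA -mxtraceD -mulmxDr.
  by rewrite X0 mulmx0 mxtrace0.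
move=> /eqP; rewrite paddr_eq0 ?psd_trace_ge0 //; try exact: pd_psd.
by move=> /andP[/eqP/(pd_trace_eq0 Mpd)].
Qed.

(** An injective linear endomorphism of the space of matrices is surjective. *)
Lemma lyapunov_solvable (C : 'M[R]_n) : exists X, M *m X + X *m M = C.
Proof.
pose f := mulmx M \+ mulmxr M.
have /mulmxVp fu : row_free (lin_mx f).
  apply: inj_row_free => v; rewrite mul_rV_lin => /(congr1 vec_mx).
  rewrite mxvecK linear0 => /lyapunov_inj v0.
  by rewrite -[v]vec_mxK v0 linear0.
(* The matrix of [f] is square, so its right inverse is also a left inverse. *)
have fu' : pinvmx (lin_mx f) *m lin_mx f = 1%:M by exact: mulmx1C.
exists (vec_mx (mxvec C *m pinvmx (lin_mx f))).
apply: (can_inj mxvecK).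
by rewrite -[LHS](mul_vec_lin f) vec_mxK -mulmxA fu' mulmx1.
Qed.

(* If X is not psd, its least eigenvalue lam is negative; lam is obtained as the
   supremum of the mu such that X - mu I is psd, and on the kernel of X - lam I
   the form of C is 2 lam times the form of M. *)
Lemma lyapunov_psd (C X : 'M[R]_n) :
  psd C -> X^T = X -> M *m X + X *m M = C -> psd X.
Proof.
move=> [CT C0] XT MX; split=> // x0; rewrite leNgt; apply/negP.
rewrite -/(quad X x0) => qx0.
have s0 : 0 < quad 1%:M x0.
  apply: (proj2 (pd1 R n)); apply: contraTneq qx0 => ->.
  by rewrite /quad mulmx0 mxE ltxx.
pose E := [set mu : R | forall x, mu * quad 1%:M x <= quad X x].
have ubE : ubound E (quad X x0 / quad 1%:M x0).
  by move=> mu /(_ x0); rewrite ler_pdivlMr.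
have E0 : E !=set0.
  exists (- (n%:R ^+ 2 * `|X|)) => x; rewrite mulNr.
  by have := norm_quad_le X x; rewrite ler_norml => /andP[].
have supE : has_sup E by split=> //; exists (quad X x0 / quad 1%:M x0).
set lam := sup E.
have lam0 : lam < 0.
  apply: le_lt_trans (ge_sup E0 ubE) _.
  by rewrite pmulr_llt0 // invr_gt0.
(* The supremum is attained: for each [x] the condition on [mu] is an upper bound, which passes to
   the supremum. *)
have lamE : E lam.
  move=> x; have := quad1_ge0 x; rewrite le_eqVlt => /predU1P[s|s].
    by rewrite -s mulr0 (quad1_eq0 (esym s)) /quad mulmx0 mxE.
  rewrite -ler_pdivlMr //; apply: ge_sup => // mu /(_ x).
  by rewrite ler_pdivlMr.
have quadX' x : quad (X - lam%:M) x = quad X x - lam * quad 1%:M x.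
  have -> : X - lam%:M = X + (- lam) *: 1%:M by rewrite scaleNr scalemx1.
  by rewrite quadDl quadZl mulNr.
have X'psd : psd (X - lam%:M).
  split; first by rewrite linearB /= XT tr_scalar_mx.
  by move=> x; rewrite -/(quad _ _) quadX' subr_ge0.
have X'pd : pd (X - lam%:M).
  apply: psd_pd X'psd _ => x; rewrite mulmxBl mul_scalar_mx => /subr0_eq Xx.
  apply/eqP/negPn/negP => /(proj2 Mpd).
  have xX : x^T *m X = lam *: x^T by rewrite -{1}XT -trmx_mul Xx linearZ.
  have := C0 x; rewrite -MX mulmxDr mulmxDl !mulmxA xX -!mulmxA Xx.
  rewrite -!scalemxAr -!scalemxAl -trace_mx11 mxtraceD !mxtraceZ !trace_mx11 mulmxA.
  by move: lam0; nra.
(* Coercivity leaves room to raise [lam] by [d], against its being the supremum. *)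
have [d d0 hd] := pd_coercive X'pd.
have : E (lam + d).
  by move=> x; have := hd x; rewrite quadX' mulrDl; lra.
move=> /(sup_upper_bound supE); rewrite -/lam; lra.
Qed.

End Lyapunov.

(** * The averaging projection and symmetric matrices that kill the ones vector *)

Section Averaging.
Variables (R : realType) (n : nat).
Hypothesis n_gt0 : (0 < n)%N.
Local Notation W := (averaging R n).
Implicit Types K S : 'M[R]_n.

Lemma averaging_sym : W^T = W.
Proof. by rewrite /averaging linearZ /= trmx_mul trmxK. Qed.

Lemma averaging_ones : W *m ones R n = ones R n.
Proof.
rewrite /averaging -scalemxAl -mulmxA.
have -> : (ones R n)^T *m ones R n = n%:R%:M.
  apply/matrixP => i j; rewrite !ord1 !mxE (eq_bigr (fun=> 1)) => [|k _].
    by rewrite sumr_const card_ord eqxx mulr1n.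
  by rewrite !mxE mulr1.
by rewrite mul_mx_scalar scalerA mulVf ?scale1r // pnatr_eq0 -lt0n.
Qed.

Lemma averaging_idem : W *m W = W.
Proof. by rewrite {2 3}/averaging -scalemxAr mulmxA averaging_ones. Qed.

Lemma zero_sum_mulmx_averaging S : S *m ones R n = 0 -> S *m W = 0.
Proof. by move=> Se; rewrite /averaging -scalemxAr mulmxA Se mul0mx scaler0. Qed.

Lemma averaging_mulmx_zero_sum S : zero_sum_sym S -> W *m S = 0.
Proof.
move=> [ST Se]; apply: trmx_inj.
by rewrite trmx_mul ST averaging_sym zero_sum_mulmx_averaging // trmx0.
Qed.

Lemma zero_sum_symD S K : zero_sum_sym S -> zero_sum_sym K -> zero_sum_sym (S + K).
Proof.
by move=> [ST Se] [KT Ke]; split; rewrite ?linearD /= ?ST ?KT // mulmxDl Se Ke addr0.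
Qed.

Lemma zero_sum_symZ a S : zero_sum_sym S -> zero_sum_sym (a *: S).
Proof.
by move=> [ST Se]; split; rewrite ?linearZ /= ?ST // -scalemxAl Se scaler0.
Qed.

Lemma zero_sum_quad_center S x : zero_sum_sym S -> quad S (x - W *m x) = quad S x.
Proof.
move=> Sz; rewrite /quad.
have -> : (x - W *m x)^T *m S = x^T *m S.
  rewrite [(x - _)^T]linearB /= trmx_mul averaging_sym mulmxBl -mulmxA.
  by rewrite averaging_mulmx_zero_sum // mulmx0 subr0.
rewrite -!mulmxA mulmxBr [S *m (W *m x)]mulmxA zero_sum_mulmx_averaging ?mul0mx ?subr0 //.
by case: Sz.
Qed.

Lemma center_ones (x : 'cV[R]_n) : (x - W *m x)^T *m ones R n = 0.
Proof.
rewrite [(x - _)^T]linearB /= trmx_mul averaging_sym mulmxBl.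
by rewrite -mulmxA averaging_ones subrr.
Qed.

(** Subtracting from [x] its mean does not change [quad S x] and makes [x] orthogonal to the ones
    vector. *)
Lemma zero_sum_psd S : zero_sum_sym S ->
  (forall z : 'cV[R]_n, z^T *m ones R n = 0 -> 0 <= quad S z) -> psd S.
Proof.
move=> Sz h; split; first by case: Sz.
by move=> x; rewrite -/(quad S x) -zero_sum_quad_center // h // center_ones.
Qed.

End Averaging.

(** * Signed Laplacians: inverse of [K + W] and Lyapunov equation *)

Section SignedLaplacian.
Variables (R : realType) (n : nat).
Hypothesis n_gt0 : (0 < n)%N.
Variable K : 'M[R]_n.
Hypothesis K_signed : signed_laplacians K.
Local Notation W := (averaging R n).
Local Notation N := (invmx (K + W)).

Let K_zero_sum : zero_sum_sym K. Proof. by case: K_signed. Qed.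
Let Kw_pd : pd (K + W). Proof. by case: K_signed. Qed.
Let Kw_unit : K + W \in unitmx. Proof. exact: pd_unitmx. Qed.
Let KW : K *m W = 0.
Proof. by case: K_zero_sum => _ /zero_sum_mulmx_averaging. Qed.
Let WK : W *m K = 0. Proof. exact: averaging_mulmx_zero_sum. Qed.

(** On vectors orthogonal to the ones vector, [K] and [K + W] have the same form. *)
Lemma signed_laplacian_psd : psd K.
Proof.
apply: zero_sum_psd => // z ze; have [_ h] := pd_psd Kw_pd.
have := h z; rewrite mulmxDr mulmxDl.
suff -> : z^T *m W = 0 by rewrite mul0mx addr0.
by rewrite /averaging -scalemxAr mulmxA ze mul0mx scaler0.
Qed.

Lemma invmx_mul_averaging : N *m W = W.
Proof.
have E : (K + W) *m W = W by rewrite mulmxDl KW add0r averaging_idem.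
by rewrite -{2}E mulKmx.
Qed.

Lemma averaging_mul_invmx : W *m N = W.
Proof.
have E : W *m (K + W) = W by rewrite mulmxDr WK add0r averaging_idem.
by rewrite -{1}E mulmxK.
Qed.

(** [N] inverts [K] on the complement of the ones vector: write [K] as [(K + W) - W] and let [W]
    absorb [N]. *)
Lemma laplacian_mul_invmx : K *m N = 1%:M - W.
Proof. by rewrite -[X in X *m N](addrK W) mulmxBl mulmxV // averaging_mul_invmx. Qed.

Lemma invmx_mul_laplacian : N *m K = 1%:M - W.
Proof. by rewrite -[X in N *m X](addrK W) mulmxBr mulVmx // invmx_mul_averaging. Qed.

(** Since [K] is singular, the equation is solved for the positive definite [K + W]; the solution
    kills the ones vector, so the terms in [W] drop out. *)
Lemma signed_lyapunov_psd (C : 'M[R]_n) : psd C -> C *m ones R n = 0 ->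
  exists X, [/\ psd X, X *m ones R n = 0 & K *m X + X *m K = C].
Proof.
move=> Cpsd Ce; have [CT _] := Cpsd.
have [X XC] := lyapunov_solvable Kw_pd C.
have KwT : (K + W)^T = K + W by case: Kw_pd.
(* The transpose solves the same equation, whose solution is unique. *)
have XT : X^T = X.
  apply/eqP; rewrite -subr_eq0; apply/eqP/(lyapunov_inj Kw_pd).
  have : (K + W) *m X^T + X^T *m (K + W) = C.
    by rewrite -CT -XC [(_ + _)^T]linearD /= !trmx_mul KwT addrC.
  by rewrite mulmxBr mulmxBl addrACA => ->; rewrite -opprD XC subrr.
have Xe : X *m ones R n = 0.
  (* Applied to the ones vector, which [K + W] fixes, the equation reads [(K + W + 1) X 1 = 0]. *)
  apply: (pd_mulmx_eq0 (M := K + W + 1%:M)).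
    split=> [|x x0]; first by rewrite linearD /= KwT trmx1.
    rewrite -/(quad _ _) quadDl addr_gt0 //; first exact: (proj2 Kw_pd).
    exact: (proj2 (pd1 R n)).
  move: (congr1 (mulmx^~ (ones R n)) XC); rewrite /= Ce mulmxDl -!mulmxA.
  have -> : (K + W) *m ones R n = ones R n.
    by rewrite mulmxDl averaging_ones // (proj2 K_zero_sum) add0r.
  by move=> XCe; rewrite mulmxDl mul1mx.
exists X; split=> //; first exact: (lyapunov_psd Kw_pd Cpsd XT XC).
rewrite -XC mulmxDl mulmxDr (zero_sum_mulmx_averaging Xe) addr0.
by rewrite (averaging_mulmx_zero_sum (conj XT Xe)) addr0.
Qed.

(* Multiply the equation by (K + W)^-1, whose product with K is 1 - W, and take
   traces. *)
Lemma signed_lyapunov_trace (r : R) (Q X : 'M[R]_n) :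
  K *m X + X *m K = Q + r *: (K *m K) ->
  \tr X = \tr (W *m X) + (\tr (N *m Q) + r * \tr K) / 2.
Proof.
move=> /(congr1 (fun Y => \tr (N *m Y))) /=.
rewrite !mulmxDr !mulmxA invmx_mul_laplacian !mxtraceD [\tr (N *m X *m K)]mxtrace_mulC.
rewrite mulmxA laplacian_mul_invmx -scalemxAr mulmxA invmx_mul_laplacian mxtraceZ.
rewrite !mulmxBl !mul1mx WK subr0 !linearB /=; lra.
Qed.

End SignedLaplacian.

(** * Block form of the Lyapunov equation and closed form of the cost *)

Section Cost.
Variables (R : realType) (n : nat) (ell r : R) (Q2 : 'M[R]_n).
Implicit Types K X : 'M[R]_n.
Local Notation W := (averaging R n).
Local Notation N K := (invmx (K + W)).

Lemma mxtrace_mul_sysB (P : 'M[R]_(n + n)) :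
  \tr (P *m (sysB R n *m (sysB R n)^T)) = \tr (drsubmx P).
Proof.
rewrite -{1}[P]submxK /sysB tr_col_mx mul_col_row mulmx_block mxtrace_block.
by rewrite !(trmx0, trmx1, mulmx0, mul0mx, mulmx1, addr0, add0r, mxtrace0).
Qed.

Lemma closed_loopE K :
  closed_loop ell K = block_mx 0 1%:M (- (ell^-1)%:M) (- K).
Proof.
rewrite /closed_loop /sysA /sysB /sysC mul_col_mx mul0mx mul1mx mul_col_row.
rewrite !mulmx1 !mulmx0 opp_block_mx add_block_mx.
by rewrite !(oppr0, addr0, add0r).
Qed.

Lemma tr_closed_loop K : K^T = K ->
  (closed_loop ell K)^T = block_mx 0 (- (ell^-1)%:M) 1%:M (- K).
Proof.
move=> KT; have trN (A : 'M[R]_n) : (- A)^T = - A^T by exact: linearN.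
by rewrite closed_loopE tr_block_mx !trN trmx0 trmx1 tr_scalar_mx KT.
Qed.

Lemma lyapunov_rhsE K : K^T = K ->
  costQ Q2 + (sysC R n)^T *m K^T *m costR n r *m K *m sysC R n =
  block_mx 0 0 0 (Q2 + r *: (K *m K)).
Proof.
move=> KT; rewrite /costQ /sysC /costR KT tr_row_mx trmx0 trmx1.
rewrite mul_mx_scalar -!scalemxAl -!mulmxA [K *m (K *m _)]mulmxA mul_mx_row.
rewrite mul_col_row scale_block_mx add_block_mx.
by rewrite !(mulmx0, mul0mx, mul1mx, mulmx1, scaler0, addr0).
Qed.

Lemma quad_block_diag (A B : 'M[R]_n) (x : 'cV[R]_(n + n)) :
  quad (block_mx A 0 0 B) x = quad A (usubmx x) + quad B (dsubmx x).
Proof.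
rewrite /quad -{1 2}[x]vsubmxK tr_col_mx mul_row_block mul_row_col.
by rewrite !mulmx0 addr0 add0r mxE.
Qed.

Lemma psd_block_diag (A B : 'M[R]_n) : psd A -> psd B -> psd (block_mx A 0 0 B).
Proof.
move=> [AT A0] [BT B0]; split; first by rewrite tr_block_mx AT BT trmx0.
by move=> x; rewrite -/(quad _ _) quad_block_diag addr_ge0 //; [exact: A0|exact: B0].
Qed.

Lemma psd_drsubmx (P : 'M[R]_(n + n)) : psd P -> psd (drsubmx P).
Proof.
move=> [PT P0]; split; first by rewrite trmx_drsub PT.
move=> x; have := P0 (col_mx 0 x).
rewrite -{1}[P]submxK tr_col_mx trmx0 mul_row_block mul_row_col.
by rewrite !mul0mx mulmx0 !add0r.
Qed.

(** The upper left block of the equation makes the off-diagonal blocks of [P] opposite, so they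
    cancel in the lower right block. *)
Lemma lyapunov_solution_drsubmx K P : K^T = K -> 0 < ell ->
  lyapunov_solution ell r Q2 K P ->
  psd (drsubmx P) /\
  K *m drsubmx P + drsubmx P *m K = Q2 + r *: (K *m K).
Proof.
move=> KT ell0 [Ppsd Peq]; split; first exact: psd_drsubmx.
move: Peq; rewrite lyapunov_rhsE // tr_closed_loop // closed_loopE.
rewrite -{1 2}[P]submxK !mulmx_block add_block_mx opp_block_mx => /eq_block_mx[ul _ _].
move: ul; rewrite !(mul0mx, mulmx0, mulmxN, mulNmx, add0r, mul1mx, mulmx1).
rewrite mul_scalar_mx mul_mx_scalar -opprD -scalerDr => /oppr_inj/eqP.
rewrite scaler_eq0 invr_eq0 gt_eqF //= => /eqP ur0.
by rewrite addrACA [ursubmx P + _]addrC ur0 add0r -opprD => /oppr_inj.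
Qed.

(** The factor [ell^-1] makes the off-diagonal blocks of the equation cancel. *)
Lemma lyapunov_solution_block K X : K^T = K -> 0 < ell -> psd X ->
  K *m X + X *m K = Q2 + r *: (K *m K) ->
  lyapunov_solution ell r Q2 K (block_mx (ell^-1 *: X) 0 0 X).
Proof.
move=> KT ell0 Xpsd XK; split.
  apply: psd_block_diag => //; have [XT X0] := Xpsd.
  split=> [|x]; first by rewrite linearZ /= XT.
  by rewrite -/(quad _ _) quadZl mulr_ge0 ?invr_ge0 ?(ltW ell0) //; exact: X0.
rewrite lyapunov_rhsE // -XK tr_closed_loop // closed_loopE !mulmx_block add_block_mx.
rewrite opp_block_mx.
rewrite !(mulmx0, mul0mx, addr0, add0r, mulmx1, mul1mx, mulNmx, mulmxN).
by rewrite mul_scalar_mx mul_mx_scalar addNr subrr oppr0 -opprD.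
Qed.

Definition cost_formula K := (\tr (N K *m Q2) + r * \tr K) / 2.

Hypothesis n_gt0 : (0 < n)%N.
Hypothesis ell_gt0 : 0 < ell.
Hypothesis r_gt0 : 0 < r.
Hypothesis Q2_psd : psd Q2.
Hypothesis Q2_ones : Q2 *m ones R n = 0.

Lemma mxtrace_averaging_mul X : \tr (W *m X) = n%:R^-1 * quad X (ones R n).
Proof.
by rewrite /averaging -scalemxAl mxtraceZ -mulmxA mxtrace_mulC trace_mx11.
Qed.

Lemma costE K : signed_laplacians K -> cost ell r Q2 K = cost_formula K.
Proof.
move=> Ks; have [[KT Ke] _] := Ks; have [_ Q20] := Q2_psd.
have [X [Xpsd Xe XK]] : exists X, [/\ psd X, X *m ones R n = 0 &
    K *m X + X *m K = Q2 + r *: (K *m K)].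
  apply: (signed_lyapunov_psd n_gt0 Ks); last first.
    by rewrite mulmxDl Q2_ones -scalemxAl -mulmxA Ke mulmx0 scaler0 addr0.
  split; first by rewrite linearD linearZ /= trmx_mul KT (proj1 Q2_psd).
  move=> x; rewrite -/(quad _ _) quadDl quadZl addr_ge0 //; first exact: Q20.
  rewrite mulr_ge0 ?(ltW r_gt0) //.
  have -> : quad (K *m K) x = quad 1%:M (K *m x).
    by rewrite /quad mulmx1 trmx_mul KT !mulmxA.
  exact: quad1_ge0.
pose P0 := block_mx (ell^-1 *: X) 0 0 X.
have trP0 : \tr (P0 *m (sysB R n *m (sysB R n)^T)) = cost_formula K.
  rewrite mxtrace_mul_sysB block_mxKdr (signed_lyapunov_trace n_gt0 Ks XK).
  by rewrite mxtrace_averaging_mul /quad -mulmxA Xe mulmx0 mxE mulr0 add0r.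
(* The excess of the trace over the formula is [\tr (W X)], a nonnegative multiple of the form of
   [X] at the ones vector. *)
have lower P : lyapunov_solution ell r Q2 K P ->
    cost_formula K <= \tr (P *m (sysB R n *m (sysB R n)^T)).
  move=> /(lyapunov_solution_drsubmx KT ell_gt0)[[_ D0] DK].
  rewrite mxtrace_mul_sysB (signed_lyapunov_trace n_gt0 Ks DK) lerDr.
  rewrite mxtrace_averaging_mul; apply: mulr_ge0; last exact: D0.
  by rewrite invr_ge0 ler0n.
have P0sol := lyapunov_solution_block KT ell_gt0 Xpsd XK.
rewrite /cost /least_lyapunov; set S := is_minimizer _ _.
(* [P0] attains the lower bound, so [xget] returns a genuine minimizer; whichever it is, its trace
   is the same. *)
have [Psol Pmin] : S (xget 0 S).
  by apply: xgetPex; exists P0; split; [exact: P0sol|move=> P /lower; rewrite trP0].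
by apply/eqP; rewrite eq_le lower // -trP0 Pmin.
Qed.

End Cost.

(** * Gradients on the zero-sum space and perturbation of the inverse *)

Section Gradient.
Variable R : realType.

(** Test with [E = s D] for small [s]: both sides are linear in [s], and [eps] can be chosen too
    small for the inequality. *)
Lemma zero_sum_trace_eq0 n (D : 'M[R]_n) : zero_sum_sym D ->
  (forall eps : R, 0 < eps -> \forall E \near (0 : 'M[R]_n), zero_sum_sym E ->
     \tr (D *m E) <= eps * `|E|) ->
  D = 0.
Proof.
move=> Dz h; apply: mxtrace_trmx_mul_eq0; rewrite (proj1 Dz).
set t := \tr _.
have t0 : 0 <= t by rewrite /t -{1}(proj1 Dz) mxtrace_trmx_mul_ge0.
apply/eqP; rewrite eq_le t0 andbT leNgt; apply/negP => tgt0.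
have D1 : 0 < `|D| + 1 by rewrite ltr_wpDl.
(* With this [eps], the product [eps * |D|] is less than [t]; the [+ 1] allows for [D] of norm 0. *)
have /h/nbhs_norm0P[d /= d0 hd] : 0 < t / 2 / (`|D| + 1) by rewrite !divr_gt0.
pose s := d / 2 / (`|D| + 1); have s0 : 0 < s by rewrite !divr_gt0.
have ns : `|s *: D| = s * `|D| by rewrite normrZ gtr0_norm.
have sd : `|s *: D| < d.
  rewrite ns /s -mulrA [_^-1 * _]mulrC mulrA ltr_pdivrMr //.
  have := normr_ge0 D; move: d0; nra.
have := hd _ sd (zero_sum_symZ s Dz).
rewrite -scalemxAr mxtraceZ ns mulrCA ler_pM2l // -/t.
rewrite [_ / (_ + 1) * _]mulrAC ler_pdivlMr //.
have := normr_ge0 D; move: tgt0; nra.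
Qed.

Lemma is_gradient_unique n (f : 'M[R]_n -> R) (K G H : 'M[R]_n) :
  is_gradient f K G -> is_gradient f K H -> G = H.
Proof.
move=> [Gz hG] [Hz hH]; apply/eqP; rewrite -subr_eq0; apply/eqP.
apply: zero_sum_trace_eq0 => [|eps eps0].
  by rewrite -scaleN1r; apply: zero_sum_symD => //; exact: zero_sum_symZ.
have e2 : 0 < eps / 2 by rewrite divr_gt0.
apply: filterS2 (hG _ e2) (hH _ e2) => E gE hE Ez.
have := gE Ez; have := hE Ez.
rewrite mulmxBl linearB /= !ler_norml => /andP[_ +] /andP[+ _]; lra.
Qed.

(** At a local minimum the first-order expansion bounds [- \tr (G E)] by [eps * |E|], so [- G]
    passes the test for being 0. *)
Lemma minimizer_gradient0 n (f : 'M[R]_n -> R) (K G : 'M[R]_n) :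
  is_gradient f K G ->
  (\forall E \near (0 : 'M[R]_n), zero_sum_sym E -> f K <= f (K + E)) -> G = 0.
Proof.
move=> [Gz hG] hmin; apply: oppr_inj; rewrite oppr0.
apply: zero_sum_trace_eq0 => [|eps eps0].
  by rewrite -scaleN1r; exact: zero_sum_symZ.
apply: filterS2 (hG _ eps0) hmin => E gE fE Ez.
have := gE Ez; have := fE Ez.
rewrite mulNmx linearN /= ler_norml => + /andP[_ +]; lra.
Qed.

Lemma signed_laplacians_open n (K : 'M[R]_n) : signed_laplacians K ->
  \forall E \near (0 : 'M[R]_n), zero_sum_sym E -> signed_laplacians (K + E).
Proof.
move=> [Kz Kpd]; have [d d0 hd] := pd_open Kpd.
apply: filterS (nbhs0_lt d0) => E Ed Ez; split; first exact: zero_sum_symD.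
by rewrite addrAC; apply: hd => //; case: Ez.
Qed.

(** Write [N], [Y] for the inverses of [A], [A + E]. Substitute [Y = N - Y E N] into
    [Y = N - N E Y]; the expansion is exact. *)
Lemma invmx_expand n (A E : 'M[R]_n) : A \in unitmx -> A + E \in unitmx ->
  invmx (A + E) = invmx A - invmx A *m E *m invmx A
    + invmx A *m E *m invmx (A + E) *m E *m invmx A.
Proof.
move=> Au Bu; set N := invmx A; set Y := invmx (A + E).
have Y1 : Y = N - N *m E *m Y.
  have : N *m ((A + E) *m Y) = N by rewrite mulmxV // mulmx1.
  rewrite mulmxDl mulmxDr mulKmx // mulmxA => {1}<-.
  by rewrite addrK.
have Y2 : Y = N - Y *m E *m N.
  have : (Y *m (A + E)) *m N = N by rewrite mulVmx // mul1mx.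
  by rewrite mulmxDr mulmxDl mulmxK // => {1}<-; rewrite addrK.
by rewrite {1}Y1 {1}Y2 mulmxBr opprB addrA addrAC !mulmxA.
Qed.

(** In [Y = N - N E Y] the last term has norm at most half that of [Y], and can be absorbed on the
    left. *)
Lemma norm_invmx_le n (A E : 'M[R]_n) : A \in unitmx -> A + E \in unitmx ->
  n%:R ^+ 2 * `|invmx A| * `|E| <= 2^-1 ->
  `|invmx (A + E)| <= 2 * `|invmx A|.
Proof.
move=> Au Bu hE; set N := invmx A in hE *; set Y := invmx (A + E).
have Y1 : Y = N - N *m E *m Y.
  have : N *m ((A + E) *m Y) = N by rewrite mulmxV // mulmx1.
  rewrite mulmxDl mulmxDr mulKmx // mulmxA => {1}<-.
  by rewrite addrK.
have : `|Y| <= `|N| + `|N *m E *m Y| by rewrite {1}Y1 ler_normB.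
have h1 := mx_norm_mul (N *m E) Y.
have h2 : n%:R * (`|N *m E| * `|Y|) <= n%:R ^+ 2 * `|N| * `|E| * `|Y|.
  have -> : n%:R ^+ 2 * `|N| * `|E| * `|Y| = n%:R * (n%:R * (`|N| * `|E|) * `|Y|).
    by ring.
  by rewrite ler_wpM2l // ler_wpM2r // mx_norm_mul.
have := ler_wpM2r (normr_ge0 Y) hE; lra.
Qed.

Lemma norm_mxtrace_mul n (A B : 'M[R]_n) : `|\tr (A *m B)| <= n%:R ^+ 2 * `|A| * `|B|.
Proof.
rewrite (le_trans (norm_mxtrace _)) // expr2 -!mulrA ler_wpM2l //.
exact: mx_norm_mul.
Qed.

End Gradient.

(** * Gradient of the cost, its zeros, and the comparison of costs *)

Section CostGradient.
Variables (R : realType) (n : nat) (ell r : R) (Q2 : 'M[R]_n).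
Implicit Types K : 'M[R]_n.
Hypothesis n_gt0 : (0 < n)%N.
Hypothesis ell_gt0 : 0 < ell.
Hypothesis r_gt0 : 0 < r.
Hypothesis Q2_psd : psd Q2.
Hypothesis Q2_ones : Q2 *m ones R n = 0.
Local Notation W := (averaging R n).
Local Notation N K := (invmx (K + W)).
Local Notation J := (cost ell r Q2).

Definition cost_gradient K : 'M[R]_n :=
  - 2^-1 *: (N K *m Q2 *m N K) + (r / 2) *: (1%:M - W).

Lemma cost_gradient_zero_sum K : signed_laplacians K -> zero_sum_sym (cost_gradient K).
Proof.
move=> [Kz Kpd]; have NT : (N K)^T = N K by case: (pd_invmx Kpd).
have Ne : N K *m ones R n = ones R n.
  have E : (K + W) *m ones R n = ones R n.
    by rewrite mulmxDl averaging_ones // (proj2 Kz) add0r.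
  by rewrite -{1}E mulKmx // pd_unitmx.
apply: zero_sum_symD; apply: zero_sum_symZ; split.
- by rewrite !trmx_mul NT (proj1 Q2_psd) mulmxA.
- by rewrite -!mulmxA Ne Q2_ones mulmx0.
- by rewrite linearB /= trmx1 averaging_sym.
- by rewrite mulmxBl mul1mx averaging_ones // subrr.
Qed.

(** The linear terms of the expansion of the inverse cancel against the gradient, since [W E = 0];
    only the term quadratic in [E] remains. *)
Lemma cost_formula_expand K E : signed_laplacians K -> zero_sum_sym E ->
    signed_laplacians (K + E) ->
  cost_formula r Q2 (K + E) - cost_formula r Q2 K - \tr (cost_gradient K *m E) =
  2^-1 * \tr (N K *m E *m N (K + E) *m E *m N K *m Q2).
Proof.
move=> [_ Kpd] Ez [_ KEpd]; rewrite /cost_formula /cost_gradient.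
have [Ku KEu] := (pd_unitmx Kpd, pd_unitmx KEpd).
have -> : \tr ((- 2^-1 *: (N K *m Q2 *m N K) + (r / 2) *: (1%:M - W)) *m E) =
    - 2^-1 * \tr (N K *m E *m N K *m Q2) + r / 2 * \tr E.
  rewrite mulmxDl -!scalemxAl mulmxBl mul1mx averaging_mulmx_zero_sum // subr0.
  by rewrite mxtraceD !mxtraceZ -[_ *m E]mulmxA mxtrace_mulC mulmxA.
rewrite (addrAC K E W) in KEu *; rewrite {1}(invmx_expand Ku KEu).
rewrite !mulmxDl mulNmx !mxtraceD [\tr (- _)]linearN /=; lra.
Qed.

Lemma cost_is_gradient K : signed_laplacians K -> is_gradient J K (cost_gradient K).
Proof.
move=> Ks; split; first exact: cost_gradient_zero_sum.
move=> eps eps0.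
(* [a * |E| <= 1/2] gives [|Y| <= 2 * |N|]. The remainder is then at most [c * |E| ^ 2]: four
   products give [n ^ 4], the trace against [Q2] gives [n ^ 2], and the 2 cancels the factor 1/2. *)
pose a := n%:R ^+ 2 * `|N K|; pose c := n%:R ^+ 6 * `|N K| ^+ 3 * `|Q2|.
have a0 : 0 <= a by rewrite mulr_ge0 // sqr_ge0.
have c0 : 0 <= c by rewrite !mulr_ge0 // exprn_ge0.
have m0 : 0 < Num.min (1 / (2 * (a + 1))) (eps / (c + 1)).
  by rewrite lt_min !divr_gt0 //; lra.
have small : \forall E \near (0 : 'M[R]_n),
    `|E| < Num.min (1 / (2 * (a + 1))) (eps / (c + 1)).
  exact: nbhs0_lt.
apply: filterS2 (signed_laplacians_open Ks) small => E KE.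
rewrite lt_min !ltr_pdivlMr; try lra.
move=> /andP[Ea Ec] Ez; have {}KE := KE Ez.
rewrite !costE // cost_formula_expand //; set Y := N (K + E).
have YN : `|Y| <= 2 * `|N K|.
  rewrite /Y addrAC; apply: norm_invmx_le.
  - by apply: pd_unitmx; case: Ks.
  - by rewrite addrAC; apply: pd_unitmx; case: KE.
  - have := normr_ge0 E; rewrite -/a; lra.
have mulle (A B : 'M[R]_n) x : `|A| <= x -> `|A *m B| <= n%:R * (x * `|B|).
  move=> Ax; rewrite (le_trans (mx_norm_mul _ _)) // ler_wpM2l //.
  by rewrite ler_wpM2r.
have := mulle _ (N K) _ (mulle _ E _ (mulle _ Y _ (mulle _ E _ (lexx `|N K|)))).
set T := N K *m E *m Y *m E *m N K => hT.
have hc : `|T| * (n%:R ^+ 2 * `|Q2|) <= 2 * c * `|E| ^+ 2.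
  apply: (le_trans (ler_wpM2r _ hT)); first by rewrite mulr_ge0 // sqr_ge0.
  have -> : n%:R * (n%:R * (n%:R * (n%:R * (`|N K| * `|E|) * `|Y|) * `|E|) * `|N K|) *
      (n%:R ^+ 2 * `|Q2|) =
    n%:R ^+ 6 * `|N K| ^+ 2 * `|Q2| * `|E| ^+ 2 * `|Y| by ring.
  have -> : 2 * c * `|E| ^+ 2 =
    n%:R ^+ 6 * `|N K| ^+ 2 * `|Q2| * `|E| ^+ 2 * (2 * `|N K|) by rewrite /c; ring.
  by rewrite ler_wpM2l // !mulr_ge0 // exprn_ge0.
have hQ := norm_mxtrace_mul T Q2.
rewrite normrM gtr0_norm ?invr_gt0 //.
have Ee : c * `|E| ^+ 2 <= eps * `|E|.
  rewrite expr2 mulrA ler_wpM2r //; have := normr_ge0 E; lra.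
have hQ' : n%:R ^+ 2 * `|T| * `|Q2| = `|T| * (n%:R ^+ 2 * `|Q2|) by ring.
by move: hQ; rewrite hQ'; lra.
Qed.

(** Since [N K K N = 1 - W], the gradient factors as [N (r K K - Q2) N / 2] with [N] invertible. *)
Lemma cost_gradient_eq0 K : signed_laplacians K ->
  (cost_gradient K = 0 <-> Q2 = r *: (K *m K)).
Proof.
move=> Ks; have [Kz Kpd] := Ks; have Ku := pd_unitmx Kpd.
have gE : cost_gradient K = 2^-1 *: (N K *m (r *: (K *m K) - Q2) *m N K).
  rewrite /cost_gradient mulmxBr mulmxBl -scalemxAr -scalemxAl !mulmxA.
  rewrite (invmx_mul_laplacian n_gt0 Ks) -[(_ - _) *m K *m _]mulmxA.
  rewrite (laplacian_mul_invmx n_gt0 Ks).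
  have -> : (1%:M - W) *m (1%:M - W) = 1%:M - W.
    by rewrite mulmxBr mulmx1 mulmxBl mul1mx averaging_idem // subrr subr0.
  by rewrite [RHS]scalerBr scalerA [2^-1 * r]mulrC addrC scaleNr.
rewrite gE; split=> [/eqP|<-]; last by rewrite subrr mulmx0 mul0mx scaler0.
rewrite scaler_eq0 invr_eq0 pnatr_eq0 /= => /eqP h; apply/esym/subr0_eq.
move: (congr1 (fun Y => (K + W) *m Y *m (K + W)) h).
by rewrite /= mulmx0 mul0mx -!mulmxA mulVmx // mulmx1 mulKVmx.
Qed.

Lemma optimal_gainP K : signed_laplacians K ->
  (Q2 = r *: (K *m K) <-> K = (Num.sqrt r)^-1 *: psd_sqrt Q2).
Proof.
move=> Ks; have sr0 : 0 < Num.sqrt r by rewrite sqrtr_gt0.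
have srr : Num.sqrt r * Num.sqrt r = r by rewrite -expr2 sqr_sqrtr // ltW.
split=> [Q2E|KE].
  have -> : psd_sqrt Q2 = Num.sqrt r *: K.
    apply: psd_sqrt_unique; last by rewrite -scalemxAl -scalemxAr scalerA srr.
    have [KT K0] := signed_laplacian_psd n_gt0 Ks.
    split=> [|x]; first by rewrite linearZ /= KT.
    by rewrite -/(quad _ _) quadZl mulr_ge0 ?sqrtr_ge0 //; exact: K0.
  by rewrite scalerA mulVf ?gt_eqF // scale1r.
have [[_ SS]|S0] := psd_sqrtP Q2.
  rewrite KE -scalemxAl -scalemxAr !scalerA SS -mulrA -invfM srr mulfV ?gt_eqF //.
  by rewrite scale1r.
(* Here K = 0, so the averaging matrix is pd, hence invertible and equal to 1. *)
have K0 : K = 0 by rewrite KE S0 scaler0.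
have Wu : W \in unitmx by case: Ks => _ /pd_unitmx; rewrite K0 add0r.
rewrite K0 mul0mx scaler0 -[Q2](mulmxK Wu).
by rewrite (zero_sum_mulmx_averaging Q2_ones) mul0mx.
Qed.

(** In the expanded square the cross terms reduce to [S], because [N] inverts [K] up to [W] and [W]
    kills [S]. *)
Lemma cost_diff K S : signed_laplacians K -> signed_laplacians S ->
  Q2 = r *: (S *m S) ->
  J K - J S = r / 2 * \tr ((S - K)^T *m N K *m (S - K)).
Proof.
move=> Ks Ss Q2E; rewrite !costE // /cost_formula Q2E.
have [[KT _] _] := Ks; have [[ST Se] _] := Ss.
have SW := zero_sum_mulmx_averaging Se.
have WS := averaging_mulmx_zero_sum (proj1 Ss).
have WK := averaging_mulmx_zero_sum (proj1 Ks).
have trK : \tr (N K *m (r *: (S *m S))) = r * \tr (S *m N K *m S).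
  by rewrite -scalemxAr mxtraceZ mulmxA mxtrace_mulC mulmxA.
have trS : \tr (N S *m (r *: (S *m S))) = r * \tr S.
  rewrite -scalemxAr mxtraceZ mulmxA (invmx_mul_laplacian n_gt0 Ss).
  by rewrite mulmxBl mul1mx WS subr0.
have -> : (S - K)^T *m N K *m (S - K) = S *m N K *m S - S - (S - K).
  rewrite [(S - K)^T]linearB /= ST KT [_ *m N K]mulmxBl.
  rewrite (laplacian_mul_invmx n_gt0 Ks) mulmxBl; congr (_ - _).
    rewrite mulmxBr -[S *m N K *m K]mulmxA (invmx_mul_laplacian n_gt0 Ks).
    by rewrite mulmxBr mulmx1 SW subr0.
  by rewrite mulmxBl mul1mx mulmxBr WS WK !subr0.
rewrite trK trS !linearB /=; lra.
Qed.

End CostGradient.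

(** [Kstar] may have positive off-diagonal entries; by the second clause the gradient then vanishes
    nowhere on [laplacians]. Hence the condition in the third clause; the fourth drops the sign
    constraints. *)
Theorem proposition3 (R : realType) (n : nat) (ell r : R) (Q2 : 'M[R]_n)
    (n_ge1 : (1 <= n)%N) (ell_gt0 : 0 < ell) (r_gt0 : 0 < r)
    (Q2_sym : Q2^T = Q2) (Q2_ones : Q2 *m ones R n = 0)
    (Q2_pos : forall z : 'cV[R]_n, z != 0 -> z^T *m ones R n = 0 ->
                0 < (z^T *m Q2 *m z) 0 0) :
  let J := cost ell r Q2 in
  let Kstar := (Num.sqrt r)^-1 *: psd_sqrt Q2 in
  [/\ forall K : 'M[R]_n, laplacians K ->
        is_gradient J K
          (- 2^-1 *: (invmx (K + averaging R n) *m Q2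
                        *m invmx (K + averaging R n))
           + (r / 2) *: (1%:M - averaging R n)),
      forall K : 'M[R]_n, laplacians K -> (is_gradient J K 0 <-> K = Kstar),
      laplacians Kstar ->
        forall K : 'M[R]_n, laplacians K ->
          (is_minimizer (@laplacians R n) J K <-> K = Kstar)
    & forall K : 'M[R]_n, signed_laplacians K ->
        (is_minimizer (@signed_laplacians R n) J K <-> K = Kstar)].
Proof.
move=> J Kstar.
have Q2_psd : psd Q2.
  apply: (zero_sum_psd n_ge1) => // z ze; have [->|z0] := eqVneq z 0.
    by rewrite /quad mulmx0 mxE.
  exact/ltW/Q2_pos.
have lap_signed (K : 'M[R]_n) : laplacians K -> signed_laplacians K.
  by case=> KT Ke Kpd _.
have grad (K : 'M[R]_n) :=
  @cost_is_gradient R n ell r Q2 n_ge1 ell_gt0 r_gt0 Q2_psd Q2_ones K.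
have starP (K : 'M[R]_n) := @optimal_gainP R n r Q2 n_ge1 r_gt0 Q2_ones K.
have grad0 (K : 'M[R]_n) : signed_laplacians K -> (is_gradient J K 0 <-> K = Kstar).
  move=> Ks; have gP := cost_gradient_eq0 r Q2 n_ge1 Ks.
  split=> [g0|/(starP K Ks)/gP <-]; last exact: grad.
  by apply/(starP K Ks)/gP; exact: is_gradient_unique (grad K Ks) g0.
have square (K S : 'M[R]_n) :=
  @cost_diff R n ell r Q2 n_ge1 ell_gt0 r_gt0 Q2_psd Q2_ones K S.
have N_pd (K : 'M[R]_n) : signed_laplacians K -> pd (invmx (K + averaging R n)).
  by move=> [_ /pd_invmx].
(* The cost difference is a form in [S - K] that is nonnegative and, [N] being positive definite,
   zero only for [K = S]. *)
have star_min (K S : 'M[R]_n) : signed_laplacians K -> signed_laplacians S ->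
    S = Kstar -> J S <= J K /\ (J K <= J S -> K = Kstar).
  move=> Ks Ss SE; have := square K S Ks Ss ((starP S Ss).2 SE).
  have := psd_trace_ge0 (S - K) (pd_psd (N_pd K Ks)).
  set t := \tr _ => t0 JKS; have r2 : 0 < r / 2 by rewrite divr_gt0.
  split=> [|KS]; first by rewrite -subr_ge0 JKS mulr_ge0 // ltW.
  have /(pd_trace_eq0 (N_pd K Ks))/subr0_eq <- // : t = 0.
  by apply/eqP; rewrite eq_le t0 andbT -(pmulr_rle0 _ r2) -JKS subr_le0.
split=> [K /lap_signed/grad//|K /lap_signed/grad0//|starL K KL|K Ks].
(* The sign constraints may be active at a minimizer, so the gradient is no guide here; [K] is
   compared directly with [Kstar]. *)
- split=> [[_ Kmin]|KE].
    have [_] := star_min K Kstar (lap_signed _ KL) (lap_signed _ starL) erefl.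
    by apply; exact: Kmin.
  by split=> // S /lap_signed Ss; case: (star_min S K Ss (lap_signed _ KL) KE).
- split=> [[_ Kmin]|KE]; last by split=> // S Ss; case: (star_min S K Ss Ks KE).
  (* The signed Laplacians are open in the zero-sum space, so the gradient vanishes at a
     minimizer. *)
  apply/grad0 => //; rewrite -(minimizer_gradient0 (grad K Ks)); first exact: grad.
  by apply: filterS (signed_laplacians_open Ks) => E KE /KE/Kmin.
Qed.
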